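(* Let $A_\bullet=(A_k)_{k=0}^\infty$ be a sequence of matrices in $\mathbb{C}^{d\times d}$, let $S\in\mathbb{C}^{d\times d}$, and let $P\in\mathbb{C}^{d\times d}$ with $P\succ0$. If $\sum_{k=0}^\infty A_k$ is $(\mathsf{E},P)$-summable to $S$, then $\sum_{k=0}^\infty A_k$ is weakly Borel summable to $S$ and strongly Borel summable to $S$.
   Context: $P\succ0$ means $P$ is positive definite: $x^*Px>0$ for all nonzero $x\in\mathbb{C}^d$ (so $P$ is Hermitian). A series of matrices equals $S$ in the conventional sense (is conventionally summable to $S$) if its partial sums converge to $S$ in any matrix norm. The $P$-Euler transform is $\mathscr{E}^P_n(A_\bullet)=\sum_{k=0}^n\binom nk(I+P)^{-n-1}P^{n-k}A_k$, and $\sum_{k=0}^\infty A_k$ is $(\mathsf{E},P)$-summable to $S$ if $\sum_{n=0}^\infty\mathscr{E}^P_n(A_\bullet)=S$ in the conventional sense. With $S_n=\sum_{k=0}^nA_k$, put, for $x>0$, $$\mathscr{WB}(A_\bullet)(x)=\sum_{k=0}^\infty S_k\frac{x^k}{k!},\qquad\mathscr{SB}(A_\bullet)(x)=\sum_{k=0}^\infty A_k\frac{x^k}{k!}.$$ The series $\sum_{k=0}^\infty A_k$ is weakly Borel summable to $S$ if the series $e^{-x}\mathscr{WB}(A_\bullet)(x)$ is conventionally summable for all $x>0$ and $\lim_{x\to\infty}e^{-x}\mathscr{WB}(A_\bullet)(x)=S$. It is strongly Borel summable to $S$ if $\int_0^xe^{-t}\mathscr{SB}(A_\bullet)(t)\,dt$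 is well defined, with the series $\mathscr{SB}(A_\bullet)$ conventionally summable, for all $x>0$, and $\int_0^\infty e^{-x}\mathscr{SB}(A_\bullet)(x)\,dx=\lim_{x\to\infty}\int_0^xe^{-t}\mathscr{SB}(A_\bullet)(t)\,dt=S$. *)

(* Defs.v *)
From HB Require Import structures.
From mathcomp Require Import all_boot all_order all_algebra.
From mathcomp Require Import complex.
From mathcomp Require Import all_classical all_reals all_analysis.

Set Implicit Arguments.
Unset Strict Implicit.
Unset Printing Implicit Defensive.

Import Order.TTheory GRing.Theory Num.Theory.
Import numFieldNormedType.Exports.

Local Open Scope classical_set_scope.
Local Open Scope ring_scope.
Local Open Scope sesquilinear_scope.
Local Open Scope complex_scope.

(* R[i] packaged as an abstract numClosedFieldType, so that the norm and the
   topology which MathComp-Analysis puts on numeric fields are found on it. *)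
Definition complexF (R : realType) : numClosedFieldType := R[i].

(* The order of complexF R is partial: 0 < z says that z is real and positive,
   so this condition forces P to be Hermitian. *)
Definition posdefmx (R : realType) (d : nat) (P : 'M[complexF R]_d) : Prop :=
  forall x : 'cV[complexF R]_d, x != 0 -> 0 < (x ^t* *m P *m x) 0 0.

(* The topology of 'M[complexF R]_d is that of the max norm of the entries;
   all norms on this finite-dimensional space are equivalent. *)
Definition mx_summable_to (R : realType) (d : nat) (u : nat -> 'M[complexF R]_d)
    (S : 'M[complexF R]_d) : Prop :=
  series u @ \oo --> S.

Definition mx_summable (R : realType) (d : nat) (u : nat -> 'M[complexF R]_d) :
    Prop :=
  exists S, mx_summable_to u S.

(* Meaningful only when mx_summable u holds. *)
Definition mx_sum (R : realType) (d : nat) (u : nat -> 'M[complexF R]_d) :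
    'M[complexF R]_d :=
  limn (series u).

(* invmx is the inverse here because P, hence 1 + P, is positive definite. *)
Definition euler_transform (R : realType) (d : nat) (P : 'M[complexF R]_d)
    (A : nat -> 'M[complexF R]_d) (n : nat) : 'M[complexF R]_d :=
  \sum_(k < n.+1)
    'C(n, k)%:R *: (invmx (1%:M + P) ^+ n.+1 *m P ^+ (n - k) *m A k).

Definition euler_summable_to (R : realType) (d : nat) (P : 'M[complexF R]_d)
    (A : nat -> 'M[complexF R]_d) (S : 'M[complexF R]_d) : Prop :=
  mx_summable_to (euler_transform P A) S.

Definition borel_term (R : realType) (d : nat) (u : nat -> 'M[complexF R]_d)
    (x : R) (k : nat) : 'M[complexF R]_d :=
  (x ^+ k / k`!%:R)%:C *: u k.

Definition partial_sum (R : realType) (d : nat) (A : nat -> 'M[complexF R]_d)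
    (n : nat) : 'M[complexF R]_d :=
  \sum_(k < n.+1) A k.

Definition weak_borel (R : realType) (d : nat) (A : nat -> 'M[complexF R]_d)
    (x : R) : 'M[complexF R]_d :=
  mx_sum (borel_term (partial_sum A) x).

Definition strong_borel (R : realType) (d : nat) (A : nat -> 'M[complexF R]_d)
    (x : R) : 'M[complexF R]_d :=
  mx_sum (borel_term A x).

Definition weakly_borel_summable_to (R : realType) (d : nat)
    (A : nat -> 'M[complexF R]_d) (S : 'M[complexF R]_d) : Prop :=
  (forall x : R, 0 < x ->
     mx_summable
       (fun k => (expR (- x))%:C *: borel_term (partial_sum A) x k)) /\
  (fun x : R => (expR (- x))%:C *: weak_borel A x) @ +oo --> S.

(* Matrix-valued functions are integrated entrywise, and complex-valued ones
   through their real and imaginary parts. *)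
Definition mx_integrable (R : realType) (d : nat) (D : set R)
    (F : R -> 'M[complexF R]_d) : Prop :=
  forall i j,
    (@lebesgue_measure R).-integrable D
      (EFin \o (fun t => complex.Re (F t i j))) /\
    (@lebesgue_measure R).-integrable D
      (EFin \o (fun t => complex.Im (F t i j))).

Definition mx_integral (R : realType) (d : nat) (D : set R)
    (F : R -> 'M[complexF R]_d) : 'M[complexF R]_d :=
  \matrix_(i, j)
    ((\int[@lebesgue_measure R]_(t in D) complex.Re (F t i j)) +i*
     (\int[@lebesgue_measure R]_(t in D) complex.Im (F t i j))).

Definition strong_borel_integrand (R : realType) (d : nat)
    (A : nat -> 'M[complexF R]_d) (t : R) : 'M[complexF R]_d :=
  (expR (- t))%:C *: strong_borel A t.

Definition strongly_borel_summable_to (R : realType) (d : nat)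
    (A : nat -> 'M[complexF R]_d) (S : 'M[complexF R]_d) : Prop :=
  (forall x : R, 0 < x ->
     mx_summable (borel_term A x) /\
     mx_integrable `[0, x] (strong_borel_integrand A)) /\
  (fun x : R => mx_integral `[0, x] (strong_borel_integrand A)) @ +oo --> S.

(* Main.v *)
Require Import Defs.
From mathcomp Require Import all_boot all_order all_algebra.
From mathcomp Require Import complex.
From mathcomp Require Import all_classical all_reals all_analysis.
From mathcomp Require Import ring lra zify.

(** The idea is to reduce to a single real sequence, and there to compare
    exponential generating functions.

    Since P is positive definite, it is diagonalizable with positive
    eigenvalues p_i.  In an eigenbasis the P-Euler transform acts row by row:
    row i undergoes the scalar Euler transform with parameter p_i.  As p_i is
    real, real and imaginary parts of the entries are transformed separately.
    Weak and strong Borel summability are inherited by linear combinations, so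
    they can be transported back to the original basis.  All of this goes
    through one predicate on real sequences, [borel_regular].

    For a real sequence a and p > 0, let b be its Euler transform and let
    M(c)(x) = exp(-x) * sum_k c_k x^k / k! be the Borel mean of c.  Two facts
    do the work.

    - The binomial transform of a multiplies the generating function of a by
      exp(p x) (a Cauchy product), so M(a)(x) = (1 + p) M(b)((1 + p) x).  The
      convergence of all these series comes from the geometric growth of a,
      which follows from the boundedness of b because the binomial transform
      with parameter p is inverted by the one with parameter - p.

    - Differentiating a Borel mean amounts to taking finite differences of the
      coefficients.  Applied to s_n = a_0 + ... + a_(n-1), this gives
      M(s)' = M(a) with M(s)(0) = 0: the Borel mean of the partial sums is the
      primitive of the Borel mean of the terms.

    Hence the Borel mean of the partial sums of a at x equals that of the
    partial sums of b at (1 + p) x, as both vanish at 0 and have the same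
    derivative.  The partial sums of b converge to S by assumption, and Borel
    means preserve limits, so M(s) tends to S.  This is strong summability,
    because M(s)(x) is the integral of M(a) over [0, x].  Weak summability uses
    the partial sums a_0 + ... + a_n instead, whose mean is M(s) + M(a), and
    M(a) tends to 0 because b does. *)

Set Implicit Arguments.
Unset Strict Implicit.
Unset Printing Implicit Defensive.
Import Order.TTheory GRing.Theory Num.Theory.
Import numFieldNormedType.Exports.
Local Open Scope classical_set_scope.
Local Open Scope ring_scope.
Local Open Scope sesquilinear_scope.
Local Open Scope complex_scope.

(** * The binomial transform *)

Section BinomialTransform.
Variable R : comPzRingType.
Implicit Types (p q : R) (a : nat -> R).

Definition binomial_transform p a n : R :=
  \sum_(k < n.+1) 'C(n, k)%:R * (p ^+ (n - k) * a k).

(** Pascal's rule: with E the shift of sequences, the transform is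
    (p + E)^n a evaluated at index 0, and this peels off one factor p + E. *)
Lemma binomial_transformS p a n :
  binomial_transform p a n.+1 =
  p * binomial_transform p a n + binomial_transform p (a \o succn) n.
Proof.
rewrite /binomial_transform big_ord_recl /= bin0 mul1r subn0.
under eq_bigr => i _ do rewrite /bump add1n subSS binS natrD mulrDl.
rewrite big_split /= addrA; congr (_ + _).
rewrite [X in _ = p * X]big_ord_recl big_ord_recr /= bin_small// mul0r addr0.
rewrite bin0 mul1r subn0 exprS mulrDr -mulrA; congr (_ + _).
rewrite mulr_sumr; apply: eq_bigr => i _; rewrite /= /bump /= add1n.
by rewrite -(subnSK (ltn_ord i)) exprS; ring.
Qed.

Lemma binomial_transformZD p (c : R) a b n :
  binomial_transform p (fun k => c * a k + b k) n =
  c * binomial_transform p a n + binomial_transform p b n.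
Proof.
rewrite /binomial_transform mulr_sumr -big_split; apply: eq_bigr => i _ /=; ring.
Qed.

Lemma binomial_transform0 a n : binomial_transform 0 a n = a n.
Proof.
rewrite /binomial_transform big_ord_recr big1 /= ?subnn ?binn ?mul1r ?add0r //.
by move=> i _; rewrite /= expr0n subn_eq0 leqNgt ltn_ord mul0r mulr0.
Qed.

Lemma eq_binomial_transform p a b : a =1 b ->
  binomial_transform p a =1 binomial_transform p b.
Proof. by move=> ab n; apply: eq_bigr => i _; rewrite ab. Qed.

(** The transforms form a one-parameter group, so that parameter - p inverts
    parameter p. *)
Lemma binomial_transformD p q a n :
  binomial_transform q (binomial_transform p a) n = binomial_transform (q + p) a n.
Proof.
elim: n a => [|n IH] a; first by
  rewrite /binomial_transform !big_ord_recl !big_ord0 /= !bin0 !subn0 !expr0; ring.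
rewrite !binomial_transformS (eq_binomial_transform _ (binomial_transformS p a)).
by rewrite binomial_transformZD !IH; ring.
Qed.

End BinomialTransform.

(** * Geometric growth *)

Section ExpBounded.
Variable R : realType.
Implicit Types (c d : nat -> R) (K : R).

(** The exponent n.+1 lets a single constant play the part of both M and K in a
    bound M * K ^ n. *)
Definition exp_bounded c := exists K, forall n, `|c n| <= K ^+ n.+1.

Lemma exp_bounded_base_ge0 c K : (forall n, `|c n| <= K ^+ n.+1) -> 0 <= K.
Proof. by move=> /(_ 0%N); apply: le_trans. Qed.

Lemma exp_bounded_geometric c (M K : R) :
  0 <= K -> (forall n, `|c n| <= M * K ^+ n) -> exp_bounded c.
Proof.
move=> K0 cM; have M0 : 0 <= M by have := cM 0%N; rewrite mulr1; apply: le_trans.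
exists ((1 + M) * (1 + K)) => n; rewrite (le_trans (cM n))// exprMn.
apply: ler_pM => //; first exact: exprn_ge0.
  by rewrite (@le_trans _ _ (1 + M)) ?ler_eXnr//; lra.
rewrite (@le_trans _ _ ((1 + K) ^+ n))//.
  by rewrite lerXn2r ?nnegrE//; lra.
by rewrite exprS ler_peMl ?exprn_ge0//; lra.
Qed.

Lemma exp_boundedZD (r : R) c d : exp_bounded c -> exp_bounded d ->
  exp_bounded (fun n => r * c n + d n).
Proof.
move=> [K Kc] [L Ld]; have [K0 L0] := (exp_bounded_base_ge0 Kc, exp_bounded_base_ge0 Ld).
apply: (@exp_bounded_geometric _ (`|r| * K + L) (K + L)) => [|n]; first lra.
rewrite (le_trans (ler_normD _ _))// normrM mulrDl -mulrA.
apply: lerD.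
  rewrite ler_wpM2l// (le_trans (Kc n))// exprS ler_wpM2l//.
  by rewrite lerXn2r// ?nnegrE//; lra.
rewrite (le_trans (Ld n))// exprS ler_wpM2l//.
by rewrite lerXn2r// ?nnegrE//; lra.
Qed.

Lemma exp_bounded0 : exp_bounded (fun=> 0).
Proof. by exists 0 => n; rewrite normr0 expr0n. Qed.

Lemma exp_bounded_cst (s : R) : exp_bounded (fun=> s).
Proof. by apply: (@exp_bounded_geometric _ `|s| 1) => // n; rewrite expr1n mulr1. Qed.

Lemma exp_bounded_shift c : exp_bounded c -> exp_bounded (c \o succn).
Proof.
move=> [K Kc]; have K0 := exp_bounded_base_ge0 Kc.
apply: (@exp_bounded_geometric _ (K ^+ 2) K) => // n.
by rewrite -exprD; exact: Kc.
Qed.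

Lemma exp_bounded_series c : exp_bounded c -> exp_bounded (series c).
Proof.
move=> [K Kc]; have K0 := exp_bounded_base_ge0 Kc.
exists (1 + K); elim=> [|n IH].
  by rewrite /series /= big_geq// normr0 expr1; lra.
rewrite seriesSr (le_trans (ler_normD _ _))//.
rewrite [leRHS]exprS mulrDl mul1r lerD// (le_trans (Kc n))// [leLHS]exprS.
rewrite ler_wpM2l// (@le_trans _ _ ((1 + K) ^+ n))//.
  by rewrite lerXn2r ?nnegrE//; lra.
by rewrite exprS ler_peMl ?exprn_ge0//; lra.
Qed.

Lemma exp_bounded_cvg c : cvgn c -> exp_bounded c.
Proof.
move=> /cvg_seq_bounded[M [Mr cM]].
apply: (@exp_bounded_geometric _ (`|M| + 1) 1) => // n.
by rewrite expr1n mulr1; apply: cM => //; rewrite (le_lt_trans (ler_norm _))// ltrDl.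
Qed.

Lemma exp_bounded_binomial_transform p c : exp_bounded c ->
  exp_bounded (binomial_transform p c).
Proof.
move=> [K Kc]; have K0 := exp_bounded_base_ge0 Kc.
apply: (@exp_bounded_geometric _ K (`|p| + K)) => [|n]; first by rewrite addr_ge0.
rewrite (le_trans (ler_norm_sum _ _ _))// exprDn mulr_sumr ler_sum// => i _.
rewrite !normrM normrX ger0_norm ?ler0n//.
rewrite (_ : K * _ = 'C(n, i)%:R * (`|p| ^+ (n - i) * K ^+ i.+1)).
  by rewrite !ler_wpM2l ?exprn_ge0.
by rewrite exprS -mulr_natl; ring.
Qed.

End ExpBounded.

(** * Cauchy products *)

Section CauchyProduct.
Variable R : realType.
Implicit Types u v w : nat -> R.

(** For large n, either n - k is large, where w is small, or k is large, where
    the tail of the series of u is small and w is bounded. *)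
Lemma cvg0_convolution u w : cvgn [normed series u] -> w @ \oo --> 0 ->
  (fun n => \sum_(k < n.+1) u k * w (n - k)%N) @ \oo --> 0.
Proof.
move=> cu w0.
have [W [W0 wW]] : exists W : R, 0 < W /\ forall n, `|w n| <= W.
  have /cvg_seq_bounded[M [Mr wM]] : cvgn w by apply/cvg_ex; exists 0.
  exists (`|M| + 1); split=> [|n]; first by rewrite ltr_wpDl.
  by apply: wM => //; rewrite (le_lt_trans (ler_norm _))// ltrDl.
pose U := limn [normed series u].
have normed_series_le n : [normed series u] n <= U.
  have nd : nondecreasing_seq [normed series u].
    by apply: (@nondecreasing_series _ _ xpredT 0%N) => k _ _ /=.
  exact: nondecreasing_cvgn_le nd cu n.
have U0 : 0 <= U by apply: le_trans (normed_series_le 0%N); rewrite /= sumr_ge0.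
apply/cvgr0Pnorm_le => e e0.
(* U + 1 and not U, which may vanish. *)
have e10 : 0 < e / 2 / (U + 1) by rewrite !divr_gt0// ltr_wpDl.
have e20 : 0 < e / 2 / W by rewrite !divr_gt0.
have /cvgr0Pnorm_le/(_ _ e10)[J _ HJ] := w0.
have /cvgrPdist_le/(_ _ e20)[N _ HN] := cu.
near=> n.
have nJN : (J + N <= n)%N by near: n; exact: nbhs_infty_ge.
have Nn : (N <= n.+1)%N by lia.
rewrite (le_trans (ler_norm_sum _ _ _))//.
rewrite -(big_mkord xpredT (fun k => `|u k * w (n - k)%N|)).
rewrite (@big_cat_nat _ _ _ N)//=.
rewrite [leRHS](splitr e) lerD//.
  rewrite (@le_trans _ _ (\sum_(0 <= k < N) `|u k| * (e / 2 / (U + 1))))//.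
    rewrite big_nat_cond [leRHS]big_nat_cond ler_sum// => k /andP[/andP[_ kN] _].
    by rewrite normrM ler_wpM2l// HJ//=; lia.
  rewrite -mulr_suml (le_trans (ler_wpM2r (ltW e10) (normed_series_le N)))//.
  rewrite mulrCA ler_piMr ?divr_ge0 ?(ltW e0)// ler_pdivrMr ?mul1r; lra.
rewrite (@le_trans _ _ (\sum_(N <= k < n.+1) `|u k| * W))//.
  by rewrite ler_sum// => k _; rewrite normrM ler_wpM2l.
rewrite -mulr_suml -ler_pdivlMr//.
have := HN N (leqnn _); rewrite ger0_norm ?subr_ge0// => le1.
rewrite -(@lerD2l _ ([normed series u] N)).
have -> : [normed series u] N + \sum_(N <= i < n.+1) `|u i| = [normed series u] n.+1.
  by rewrite /= -big_cat_nat.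
by rewrite (le_trans (normed_series_le _))// -lerBlDl.
Unshelve. all: by end_near. Qed.

(** Mertens' theorem.  The partial sums of the product series are the
    convolution of u with the partial sums of v; replacing the latter by their
    limit costs the convolution of u with a null sequence. *)
Lemma cvg_cauchy_product u v : cvgn [normed series u] -> cvgn (series v) ->
  series (fun n => \sum_(k < n.+1) u k * v (n - k)%N) @ \oo -->
    limn (series u) * limn (series v).
Proof.
move=> cu cv; set V := limn (series v).
have H : (fun n => series (fun n => \sum_(k < n.+1) u k * v (n - k)%N) n.+1) =
    (fun n => series u n.+1 * V + \sum_(k < n.+1) u k * (series v (n - k).+1 - V)).
  apply/funext => n.
  rewrite [series u _]/series /= big_mkord mulr_suml -big_split /=.
  under [RHS]eq_bigr => k _ do rewrite -mulrDr addrC subrK.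
  elim: n => [|n IH].
    by rewrite /series /= big_nat1 !big_ord1 big_nat1.
  rewrite seriesSr IH [RHS]big_ord_recr /= subnn [series v 1]/series /= big_nat1.
  rewrite [X in _ + X]big_ord_recr /= subnn addrA -big_split /=; congr (_ + _).
  by apply: eq_bigr => k _; rewrite -mulrDr subSn -1?ltnS// -seriesSr.
rewrite -cvg_shiftS H -[limn (series u) * V]addr0; apply: cvgD.
  apply: cvgM; last exact: cvg_cst.
  by rewrite cvg_shiftS; exact: normed_cvg cu.
apply: (@cvg0_convolution u (fun m => series v m.+1 - V) cu).
rewrite -(subrr V); apply: cvgB; last exact: cvg_cst.
by rewrite cvg_shiftS.
Qed.

End CauchyProduct.

(** * Exponential generating functions *)

Section Egf.
Variable R : realType.
Implicit Types (a b c d : nat -> R) (x y : R).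

Definition egf_coeff c k : R := c k / k`!%:R.

Definition egf c x : R := limn (pseries (egf_coeff c) x).

Lemma is_cvg_normed_egf c x : exp_bounded c ->
  cvgn [normed pseries (egf_coeff c) x].
Proof.
move=> [K Kc]; have K0 := exp_bounded_base_ge0 Kc.
apply: (@series_le_cvg _ _ (K *: exp_coeff (K * `|x|))) => [n|n|n|] //=.
- by rewrite /exp_coeff mulr_ge0// divr_ge0// exprn_ge0// mulr_ge0.
- rewrite /GRing.scale /= /exp_coeff /= exprMn normrM normrX /egf_coeff normrM normfV.
  rewrite (ger0_norm (ler0n _ _)).
  rewrite [leRHS](_ : _ = K ^+ n.+1 * (n`!%:R^-1 * `|x| ^+ n)).
    by rewrite -mulrA ler_wpM2r// mulr_ge0// exprn_ge0.
  by rewrite exprS /GRing.scale /=; ring.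
exact: is_cvg_seriesZ (is_cvg_series_exp_coeff _).
Qed.

Lemma is_cvg_egf c x : exp_bounded c -> cvgn (pseries (egf_coeff c) x).
Proof. by move=> cb; apply: normed_cvg; exact: is_cvg_normed_egf. Qed.

Lemma egfZD (r : R) c d x : exp_bounded c -> exp_bounded d ->
  egf (fun k => r * c k + d k) x = r * egf c x + egf d x.
Proof.
move=> cb db; rewrite /egf.
have -> : pseries (egf_coeff (fun k => r * c k + d k)) x =
    r *: pseries (egf_coeff c) x + pseries (egf_coeff d) x.
  rewrite /pseries -seriesZ -seriesD; congr series; apply/funext => k.
  transitivity (r * (egf_coeff c k * x ^+ k) + egf_coeff d k * x ^+ k) => //.
  by rewrite /= /egf_coeff; ring.
apply/cvg_lim => //; apply: cvgD; last exact: is_cvg_egf.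
by apply: cvgZl_tmp; exact: is_cvg_egf.
Qed.

Lemma egf_cst0 x : egf (fun=> 0) x = 0.
Proof.
apply/cvg_lim => //; rewrite (_ : pseries _ _ = cst 0); first exact: cvg_cst.
apply/funext => n; rewrite /pseries /series /= big1// => k _.
by rewrite /egf_coeff !mul0r.
Qed.

Lemma egfZ (r : R) c x : exp_bounded c -> egf (fun k => r * c k) x = r * egf c x.
Proof.
move=> cb; have := egfZD r x cb (exp_bounded0 R).
by rewrite egf_cst0 addr0; under eq_fun => k do rewrite addr0.
Qed.

Lemma egf0 c : egf c 0 = c 0%N.
Proof.
apply/cvg_lim => //; rewrite -cvg_shiftS (_ : [sequence _]_n = cst (c 0%N)).
  exact: cvg_cst.
apply/funext => n; rewrite /pseries /series/= big_nat_recl//= big1 => [|k _].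
  by rewrite /egf_coeff fact0 divr1 mulr1 addr0.
by rewrite exprS mul0r mulr0.
Qed.

Lemma egf_scale (r : R) c x : egf c (r * x) = egf (fun k => r ^+ k * c k) x.
Proof.
rewrite /egf; congr (limn (series _)); apply/funext => k.
by rewrite /= /egf_coeff exprMn; ring.
Qed.

Lemma egf_geometric (r : R) x : egf (fun k => r ^+ k) x = expR (r * x).
Proof.
rewrite /egf /expR; congr (limn (series _)); apply/funext => k.
by rewrite /egf_coeff /exp_coeff /= exprMn mulrAC.
Qed.

Lemma egf_le_norm c d x : 0 <= x -> exp_bounded c -> exp_bounded d ->
  (forall k, `|c k| <= d k) -> `|egf c x| <= egf d x.
Proof.
move=> x0 cb db cd; rewrite (le_trans (lim_series_norm _))//.
  exact: is_cvg_normed_egf.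
apply: lim_series_le => [||n]; [exact: is_cvg_normed_egf|exact: is_cvg_egf|].
rewrite /= /egf_coeff !normrM normfV normrX (ger0_norm x0) (ger0_norm (ler0n _ _)).
by rewrite ler_wpM2r ?exprn_ge0// ler_wpM2r// invr_ge0.
Qed.

Lemma pseries_diffs_egf_coeff c :
  pseries_diffs (egf_coeff c) = egf_coeff (c \o succn).
Proof.
apply/funext => k; rewrite /pseries_diffs /egf_coeff /= factS natrM invfM.
by rewrite mulrCA mulrA mulrA mulrK ?unitfE// mulrAC.
Qed.

Lemma is_derive_egf c x : exp_bounded c ->
  is_derive x 1 (egf c) (egf (c \o succn) x).
Proof.
move=> cb; rewrite /egf -pseries_diffs_egf_coeff.
apply: (@pseries_snd_diffs _ _ (`|x| + 1)); rewrite ?pseries_diffs_egf_coeff.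
- exact: is_cvg_egf.
- exact/is_cvg_egf/exp_bounded_shift.
- exact/is_cvg_egf/exp_bounded_shift/exp_bounded_shift.
- by rewrite [ltRHS]ger0_norm// ltrDl.
Qed.

(** The generating function of the binomial transform is the Cauchy product of
    those of the geometric sequence p ^ k and of a. *)
Lemma egf_binomial_transform p a x : exp_bounded a ->
  egf (binomial_transform p a) x = expR (p * x) * egf a x.
Proof.
move=> ab; rewrite mulrC.
have <- : limn (series (exp_coeff (p * x))) = expR (p * x) by [].
apply/cvg_lim => //.
rewrite (_ : pseries _ _ = series (fun n => \sum_(k < n.+1)
  (egf_coeff a k * x ^+ k) * exp_coeff (p * x) (n - k)%N)).
  have := is_cvg_series_exp_coeff (p * x).
  exact: cvg_cauchy_product (is_cvg_normed_egf ab).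
congr series; apply/funext => n.
rewrite /= /egf_coeff /binomial_transform mulr_suml mulr_suml.
apply: eq_bigr => k _; rewrite /exp_coeff /=.
have kn : (k <= n)%N by rewrite -ltnS.
have := bin_fact kn => /(congr1 (fun m => m%:R : R)); rewrite !natrM => <-.
rewrite exprMn (_ : x ^+ n = x ^+ k * x ^+ (n - k)); last by rewrite -exprD subnKC.
field.
by rewrite !pnatr_eq0 -!lt0n !fact_gt0 bin_gt0 kn.
Qed.

End Egf.

(** * Borel means *)

Section BorelMean.
Variable R : realType.
Implicit Types (a b c d : nat -> R) (x y : R).

Definition borel_mean c x : R := expR (- x) * egf c x.

Lemma borel_meanZD (r : R) c d x : exp_bounded c -> exp_bounded d ->
  borel_mean (fun k => r * c k + d k) x = r * borel_mean c x + borel_mean d x.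
Proof. by move=> cb db; rewrite /borel_mean egfZD//; ring. Qed.

Lemma borel_mean_cst (s : R) x : borel_mean (fun=> s) x = s.
Proof.
have e1 : exp_bounded (fun k => 1 ^+ k : R).
  by exists 1 => n; rewrite !expr1n normr1.
rewrite /borel_mean (_ : (fun=> s) = (fun k => s * 1 ^+ k)); last first.
  by apply/funext => k; rewrite expr1n mulr1.
rewrite egfZ// egf_geometric.
by rewrite mul1r mulrCA [_ * expR x]mulrC expRxMexpNx_1 mulr1.
Qed.

(** The derivative of the generating function shifts its coefficients, and that
    of the factor exp(-x) subtracts the unshifted ones. *)
Lemma is_derive_borel_mean c x : exp_bounded c ->
  is_derive x 1 (borel_mean c) (borel_mean (fun k => c k.+1 - c k) x).
Proof.
move=> cb; have dc := is_derive_egf x cb.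
rewrite /borel_mean; apply: is_derive_eq.
rewrite (_ : (fun k => _ - _) = (fun k => -1 * c k + (c \o succn) k)).
  by rewrite egfZD//; [rewrite /GRing.scale /=; ring|exact: exp_bounded_shift].
by apply/funext => k /=; ring.
Qed.

(** [series c] starts with the empty sum, so its finite differences are exactly
    the terms of c. *)
Lemma is_derive_borel_mean_series c x : exp_bounded c ->
  is_derive x 1 (borel_mean (series c)) (borel_mean c x).
Proof.
move=> cb.
rewrite [X in is_derive _ _ _ (borel_mean X x)]
  (_ : c = (fun k => series c k.+1 - series c k)).
  exact/is_derive_borel_mean/exp_bounded_series.
by apply/funext => k; rewrite seriesSB.
Qed.

Lemma borel_mean_series0 c : borel_mean (series c) 0 = 0.
Proof. by rewrite /borel_mean egf0 /series /= big_geq// mulr0. Qed.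

Lemma continuous_borel_mean c : exp_bounded c -> continuous (borel_mean c).
Proof.
move=> cb x; apply: differentiable_continuous; apply/derivable1_diffP.
by have [] := is_derive_borel_mean x cb.
Qed.

(** Up to e / 2, the null sequence c is dominated by a multiple M of the
    geometric sequence (1/2)^k, whose Borel mean is exp(- x / 2). *)
Lemma borel_mean_cvg0 c : c @ \oo --> 0 -> borel_mean c x @[x --> +oo] --> 0.
Proof.
move=> c0; have cb : exp_bounded c by apply: exp_bounded_cvg; apply/cvg_ex; exists 0.
apply/cvgr0Pnorm_le => e e0.
have e20 : 0 < e / 2 by rewrite divr_gt0.
have /cvgr0Pnorm_le/(_ _ e20)[N _ HN] := c0.
have [M [M0 cM]] : exists M : R, 0 <= M /\ forall k, `|c k| <= M * 2^-1 ^+ k + e / 2.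
  (* The term of index k < N of this sum already covers |c k|. *)
  exists (\sum_(k < N) `|c k| * 2 ^+ k); split.
    by apply: sumr_ge0 => i _; rewrite mulr_ge0.
  move=> k; have [Nk|kN] := leqP N k.
    rewrite (le_trans (HN _ Nk))// lerDr mulr_ge0//.
    by apply: sumr_ge0 => i _; rewrite mulr_ge0.
  rewrite (bigD1 (Ordinal kN))//= mulrDl exprVn mulfK ?expf_neq0// -addrA lerDl.
  rewrite addr_ge0 ?(ltW e20)// mulr_ge0//.
  by apply: sumr_ge0 => i _; rewrite mulr_ge0.
have H x : 0 <= x -> `|borel_mean c x| <= M * expR (- (x / 2)) + e / 2.
  move=> x0; rewrite normrM ger0_norm ?expR_ge0//.
  have gb : exp_bounded (fun k => 2^-1 ^+ k : R).
    by apply: (@exp_bounded_geometric _ _ 1 2^-1) => // k; rewrite mul1r ger0_norm.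
  have h := egf_le_norm x0 cb (exp_boundedZD M gb (exp_bounded_cst _)) cM.
  rewrite (le_trans (ler_wpM2l (expR_ge0 _) h))//.
  have := borel_meanZD M x gb (exp_bounded_cst (e / 2)).
  rewrite borel_mean_cst /borel_mean => ->; rewrite egf_geometric -expRD.
  by rewrite (_ : - x + 2^-1 * x = - (x / 2))//; field.
have e3 : 0 < e / 2 / (M + 1) by rewrite divr_gt0// ltr_wpDl.
have : expR (- (x / 2)) @[x --> +oo] --> (0 : R).
  apply: (@cvg_comp _ _ _ (fun x : R => x / 2) (fun x => expR (- x)) _ +oo).
    by apply: gt0_cvgMly => //; exact: cvg_id.
  exact: cvgr_expR.
move=> /cvgr0Pnorm_le/(_ _ e3) h; near=> x.
have x0 : 0 <= x by near: x; apply: nbhs_pinfty_ge; exact: num_real.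
rewrite (le_trans (H _ x0))// [leRHS](splitr e) lerD2r.
have : `|expR (- (x / 2))| <= e / 2 / (M + 1) by near: x.
rewrite ger0_norm ?expR_ge0// => /(ler_wpM2l M0) /le_trans -> //.
by rewrite mulrA ler_pdivrMr ?ltr_wpDl// mulrC ler_wpM2l ?(ltW e20)// lerDl.
Unshelve. all: by end_near. Qed.

Lemma borel_mean_cvg c (s : R) : c @ \oo --> s -> borel_mean c x @[x --> +oo] --> s.
Proof.
move=> cs; have cb : exp_bounded c by apply: exp_bounded_cvg; apply/cvg_ex; exists s.
have c0 : (fun k => -1 * s + c k) @ \oo --> 0.
  rewrite -(subrr s) addrC mulN1r; apply: cvgD => //; exact: cvg_cst.
have := borel_mean_cvg0 c0.
have -> : borel_mean (fun k => -1 * s + c k) = (fun x => - s + borel_mean c x).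
  apply/funext => x; rewrite (borel_meanZD (-1) x (exp_bounded_cst s) cb).
  by rewrite borel_mean_cst mulN1r.
move=> h; rewrite -[s]addr0 -[X in X @ _](_ : (fun x => s + (- s + borel_mean c x)) = _).
  by apply: cvgD => //; exact: cvg_cst.
by apply/funext => x; rewrite addrA subrr add0r.
Qed.

Definition euler_coeff (p : R) a n : R :=
  (1 + p) ^- n.+1 * binomial_transform p a n.

(** The sequence is recovered from its Euler transform by the binomial transform
    with parameter - p. *)
Lemma exp_bounded_euler p a : 0 < p -> exp_bounded (euler_coeff p a) ->
  exp_bounded a.
Proof.
move=> p0 [K Kb]; have K0 := exp_bounded_base_ge0 Kb.
have p1 : 0 < 1 + p by rewrite addr_gt0.
have tb : exp_bounded (binomial_transform p a).
  exists ((1 + p) * K) => n; rewrite exprMn.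
  rewrite (_ : binomial_transform p a n = (1 + p) ^+ n.+1 * euler_coeff p a n).
    by rewrite normrM normrX (gtr0_norm p1) ler_wpM2l// exprn_ge0// ltW.
  by rewrite /euler_coeff mulrA mulfV ?mul1r// expf_neq0// gt_eqF.
have := exp_bounded_binomial_transform (- p) tb.
rewrite (_ : binomial_transform _ _ = a)//; apply/funext => n.
by rewrite binomial_transformD addNr binomial_transform0.
Qed.

(** The Euler transform is the binomial transform rescaled by (1 + p) ^ - n.+1:
    the power of index n dilates the variable, one factor 1 + p remains, and
    the exponentials combine as exp(-x) = exp(-(1 + p) x) * exp(p x). *)
Lemma borel_mean_euler p a x : 0 < p -> exp_bounded (euler_coeff p a) ->
  borel_mean a x = (1 + p) * borel_mean (euler_coeff p a) ((1 + p) * x).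
Proof.
move=> p0 bb; have ab := exp_bounded_euler p0 bb.
have p1 : 0 < 1 + p by rewrite addr_gt0.
rewrite /borel_mean egf_scale.
have -> : egf (fun k => (1 + p) ^+ k * euler_coeff p a k) x =
    (1 + p)^-1 * egf (binomial_transform p a) x.
  have tb : exp_bounded (binomial_transform p a) by exact: exp_bounded_binomial_transform.
  rewrite -egfZ//; congr egf; apply/funext => k.
  rewrite /euler_coeff exprS invfM; field.
  by rewrite expf_neq0 !gt_eqF.
rewrite egf_binomial_transform// (_ : - ((1 + p) * x) = - x - p * x); last ring.
rewrite expRD (expRN (p * x)).
field; rewrite gt_eqF//=; apply/lt0r_neq0/expR_gt0.
Qed.

End BorelMean.

(** * Borel summability of real series *)

Section RealBorel.
Variable R : realType.
Implicit Types (a b c d : nat -> R) (x y : R).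

(** Joint form of weak and strong Borel summability to s for a real sequence,
    chosen to be stable under linear combinations.  The mean of [series a] is
    the integral of strong summability; adding the mean of a turns it into the
    mean of the partial sums of weak summability, which run one index further. *)
Definition borel_regular a (s : R) :=
  [/\ exp_bounded a, borel_mean a x @[x --> +oo] --> 0
    & borel_mean (series a) x @[x --> +oo] --> s].

(** Both sides vanish at 0, and by [borel_mean_euler] they have the same
    derivative. *)
Lemma borel_mean_series_euler p a x : 0 < p -> exp_bounded (euler_coeff p a) ->
  borel_mean (series a) x = borel_mean (series (euler_coeff p a)) ((1 + p) * x).
Proof.
move=> p0 bb; have ab := exp_bounded_euler p0 bb.
pose F x := borel_mean (series a) x -
  (borel_mean (series (euler_coeff p a)) \o (fun y => (1 + p) * y)) x.
suff : F x = F 0.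
  rewrite /F /= mulr0 !borel_mean_series0 subr0 => /eqP.
  by rewrite subr_eq0 => /eqP.
apply: is_derive_0_is_cst => y.
have d1 := is_derive_borel_mean_series y ab.
have d2 := is_derive_borel_mean_series ((1 + p) * y) bb.
have d3 : is_derive y 1 (fun y => (1 + p) * y) (1 + p).
  by apply: is_derive_eq; rewrite /GRing.scale /= mulr1.
have d4 := is_derive1_comp d2 d3.
rewrite /F; apply: is_derive_eq.
by rewrite (borel_mean_euler y p0 bb) /GRing.scale /= mulrC subrr.
Qed.

Lemma borel_regular_euler p a s : 0 < p ->
  series (euler_coeff p a) @ \oo --> s -> borel_regular a s.
Proof.
move=> p0 bs; have p1 : 0 < 1 + p by rewrite addr_gt0.
have b0 : euler_coeff p a @ \oo --> 0.
  by apply: cvg_series_cvg_0; apply/cvg_ex; exists s.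
have bb : exp_bounded (euler_coeff p a).
  by apply: exp_bounded_cvg; apply/cvg_ex; exists 0.
have py : (1 + p) * x @[x --> +oo] --> +oo.
  by apply: gt0_cvgMry => //; exact: cvg_id.
split; first exact: exp_bounded_euler bb.
- rewrite (funext (fun x => borel_mean_euler x p0 bb)).
  suff : (1 + p) * borel_mean (euler_coeff p a) ((1 + p) * x) @[x --> +oo] -->
    (1 + p) * 0 by rewrite mulr0.
  apply: cvgM; first exact: cvg_cst.
  exact: cvg_comp py (borel_mean_cvg0 b0).
- rewrite (funext (fun x => borel_mean_series_euler x p0 bb)).
  exact: cvg_comp py (borel_mean_cvg bs).
Qed.

Lemma borel_regularZD (r : R) a b s t : borel_regular a s -> borel_regular b t ->
  borel_regular (fun k => r * a k + b k) (r * s + t).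
Proof.
move=> [ab a0 sa] [bb b0 tb]; split; first exact: exp_boundedZD.
- rewrite (funext (fun x => borel_meanZD r x ab bb)).
  suff : r * borel_mean a x + borel_mean b x @[x --> +oo] --> r * 0 + 0.
    by rewrite mulr0 addr0.
  by apply: cvgD => //; apply: cvgM => //; exact: cvg_cst.
- have -> : series (fun k => r * a k + b k) = (fun k => r * series a k + series b k).
    by apply/funext => k; rewrite /series /= mulr_sumr -big_split.
  have sab := exp_bounded_series ab.
  have sbb := exp_bounded_series bb.
  rewrite (funext (fun x => borel_meanZD r x sab sbb)).
  by apply: cvgD => //; apply: cvgM => //; exact: cvg_cst.
Qed.

Lemma borel_regular0 : borel_regular (fun=> 0) 0.
Proof.
split; first exact: exp_bounded0.
  by rewrite (funext (borel_mean_cst 0)); exact: cvg_cst.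
have -> : series (fun=> 0 : R) = (fun=> 0).
  by apply/funext => k; rewrite /series /= big1.
by rewrite (funext (borel_mean_cst 0)); exact: cvg_cst.
Qed.

Lemma borel_regular_weak a s : borel_regular a s ->
  borel_mean (fun k => series a k.+1) x @[x --> +oo] --> s.
Proof.
move=> [ab a0 sa]; have sab := exp_bounded_series ab.
have -> : (fun k => series a k.+1) = (fun k => 1 * a k + series a k).
  by apply/funext => k; rewrite seriesSr mul1r addrC.
rewrite (funext (fun x => borel_meanZD 1 x ab sab)).
suff : 1 * borel_mean a x + borel_mean (series a) x @[x --> +oo] --> 1 * 0 + s.
  by rewrite mulr0 add0r.
by apply: cvgD => //; apply: cvgM => //; exact: cvg_cst.
Qed.

Lemma borel_mean_integrable a x : exp_bounded a ->
  (@lebesgue_measure R).-integrable `[0, x] (EFin \o borel_mean a).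
Proof.
move=> ab; apply: continuous_compact_integrable; first exact: segment_compact.
by apply: continuous_subspaceT => y; exact: continuous_borel_mean.
Qed.

Lemma borel_mean_integral a x : exp_bounded a -> 0 < x ->
  \int[@lebesgue_measure R]_(t in `[0, x]) borel_mean a t = borel_mean (series a) x.
Proof.
move=> ab x0; have sab := exp_bounded_series ab.
have cs := continuous_borel_mean sab.
rewrite /Rintegral (@continuous_FTC2 _ _ (borel_mean (series a)))//.
- by rewrite borel_mean_series0 sube0.
- by apply: continuous_subspaceT => y; exact: continuous_borel_mean.
- split => [y _||].
  + by have [] := is_derive_borel_mean_series y ab.
  + by apply: cvg_at_right_filter; exact: cs.
  + by apply: cvg_at_left_filter; exact: cs.
- by move=> y _; rewrite derive1E; have [] := is_derive_borel_mean_series y ab.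
Qed.

End RealBorel.

(** * Diagonalization of positive definite matrices *)

Section PosDef.
Variables (C : numClosedFieldType) (n : nat).
Implicit Types (P Q U : 'M[C]_n) (x y : 'cV[C]_n).

Lemma mx_form_delta Q i j :
  ((delta_mx i 0 : 'cV[C]_n) ^t* *m Q *m (delta_mx j 0 : 'cV[C]_n)) 0 0 = Q i j.
Proof.
rewrite trmx_delta map_delta_mx -rowE -colE.
by rewrite !mxE.
Qed.

(** Polarization: evaluating the form at x + y and at x + i y gives the sum and
    the difference of the two mixed terms. *)
Lemma mx_form_eq0 Q : (forall x, x ^t* *m Q *m x = 0) -> Q = 0.
Proof.
move=> Q0; apply/matrixP => i j; rewrite [RHS]mxE -mx_form_delta.
set x := delta_mx i 0; set y := delta_mx j 0.
have h1 : x ^t* *m Q *m y + y ^t* *m Q *m x = 0.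
  have := Q0 (x + y).
  rewrite [(x + y)^T]linearD /= map_mxD !(mulmxDl, mulmxDr) !Q0 add0r addr0.
  by rewrite addrC.
have h2 : x ^t* *m Q *m y - y ^t* *m Q *m x = 0.
  have := Q0 (x + 'i *: y).
  rewrite [(x + _)^T]linearD /= [('i *: y)^T]linearZ /= map_mxD map_mxZ /= conjCi.
  rewrite !(mulmxDl, mulmxDr) -!scalemxAr -!scalemxAl !Q0 !scaler0.
  rewrite add0r addr0 scaleNr addrC -scalerBr => /eqP.
  by rewrite scaler_eq0 (negPf (neq0Ci _)) /= => /eqP.
have : (x ^t* *m Q *m y) *+ 2 = 0.
  have -> : (x ^t* *m Q *m y) *+ 2 = (x ^t* *m Q *m y + y ^t* *m Q *m x) +
     (x ^t* *m Q *m y - y ^t* *m Q *m x) by rewrite addrACA subrr addr0.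
  by rewrite h1 h2 addr0.
by move/eqP; rewrite -scaler_nat scaler_eq0 pnatr_eq0 /= => /eqP ->; rewrite mxE.
Qed.

(** The form of P takes real values, so that of P - P^t* vanishes. *)
Lemma posdef_hermsym P :
  (forall x, x != 0 -> 0 < (x ^t* *m P *m x) 0 0) -> P \is hermsymmx.
Proof.
move=> P0; apply/is_hermitianmxP; rewrite expr0 scale1r.
apply/eqP; rewrite -subr_eq0; apply/eqP/mx_form_eq0 => x.
have [->|/P0 xP] := eqVneq x 0; first by rewrite mulmx0.
rewrite mulmxBr mulmxBl.
have -> : x ^t* *m P ^t* *m x = (x ^t* *m P *m x) ^t*.
  by rewrite !trmx_mul !map_mxM trmxCK mulmxA.
apply/matrixP => i j; rewrite !ord1 !mxE.
move: xP; rewrite [X in 0 < X]mxE => /gtr0_real/CrealP.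
by move=> ->; rewrite subrr.
Qed.

(** By the spectral theorem; the eigenvalue p 0 i is the value of the form at the
    unit vector given by the conjugate of row i of U. *)
Lemma posdef_diagonalization P :
  (forall x, x != 0 -> 0 < (x ^t* *m P *m x) 0 0) ->
  exists U, exists p : 'rV[C]_n, [/\ U \in unitmx, forall i, 0 < p 0 i
    & U *m P = diag_mx p *m U].
Proof.
move=> P0; have /hermitian_normalmx/orthomx_spectralP := posdef_hermsym P0.
have Uu := spectral_unitarymx P; have Un := spectral_unit P.
set U := spectralmx P in Uu Un *; set p := spectral_diag P => PE.
have UP : U *m P = diag_mx p *m U by rewrite PE !mulmxA mulmxV// mul1mx.
exists U, p; split=> // i.
have U1 : (row i U *m (row i U)^t*) 0 0 = 1.
  by have := row_unitarymxP Uu i i; rewrite dotmxE eqxx.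
have -> : p 0 i = (row i U *m P *m (row i U)^t*) 0 0.
  rewrite -row_mul UP row_mul row_diag_mx -scalemxAl -rowE -scalemxAl mxE.
  by rewrite U1 mulr1.
have := P0 ((row i U)^t*); rewrite trmxCK; apply; apply/eqP => U0.
by move: U1; rewrite U0 mulmx0 mxE => /eqP; rewrite eq_sym oner_eq0.
Qed.

End PosDef.

(** * Convergence of complex matrices by real coordinates *)

Section MatrixConvergence.

Lemma cvg_mxP (K : numFieldType) (T : Type) (F : set_system T) (FF : Filter F)
  m n (f : T -> 'M[K]_(m, n)) (L : 'M[K]_(m, n)) :
  f @ F --> L <-> forall i j, f x i j @[x --> F] --> L i j.
Proof.
split=> [fL i j|fL].
  exact: (cvg_comp _ _ fL (@coord_continuous K m n i j L)).
apply/cvg_ballP => e e0; near=> t; split => //.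
near: t.
apply: filter_forall => i; apply: filter_forall => j.
by have /cvg_ballP/(_ e e0) := fL i j.
Unshelve. all: by end_near. Qed.

Variable R : realType.
Local Notation C := (complexF R).
Implicit Types (z w : C).

Lemma complex_ReD z w : complex.Re (z + w) = complex.Re z + complex.Re w.
Proof. by case: z w => [a b] [c e]. Qed.

Lemma complex_ImD z w : complex.Im (z + w) = complex.Im z + complex.Im w.
Proof. by case: z w => [a b] [c e]. Qed.

Lemma complex_ReM z w : complex.Re (z * w) =
  complex.Re z * complex.Re w - complex.Im z * complex.Im w.
Proof. by case: z w => [a b] [c e]. Qed.

Lemma complex_ImM z w : complex.Im (z * w) =
  complex.Re z * complex.Im w + complex.Im z * complex.Re w.
Proof. by case: z w => [a b] [c e]. Qed.

Lemma complex_ReB z w : complex.Re (z - w) = complex.Re z - complex.Re w.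
Proof. by case: z w => [a b] [c e]. Qed.

Lemma complex_ImB z w : complex.Im (z - w) = complex.Im z - complex.Im w.
Proof. by case: z w => [a b] [c e]. Qed.

Lemma complex_ReZ (r : R) z : complex.Re (r%:C * z : C) = r * complex.Re z.
Proof. by rewrite complex_ReM /= mul0r subr0. Qed.

Lemma complex_ImZ (r : R) z : complex.Im (r%:C * z : C) = r * complex.Im z.
Proof. by rewrite complex_ImM /= mul0r addr0. Qed.

Lemma normc_leP z (e : R) : `|z| <= (e%:C : C) ->
  `|complex.Re z| <= e /\ `|complex.Im z| <= e.
Proof.
rewrite normc_def lecR => h; split; rewrite (le_trans _ h)// -sqrtr_sqr ler_wsqrtr//.
  by rewrite lerDl sqr_ge0.
by rewrite lerDr sqr_ge0.
Qed.

Lemma normc_le_ReIm z : `|z| <= ((`|complex.Re z| + `|complex.Im z|)%:C : C).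
Proof.
rewrite normc_def lecR -[leRHS]ger0_norm ?addr_ge0// -(sqrtr_sqr (_ + _)) ler_wsqrtr//.
by rewrite sqrrD !real_normK ?num_real// lerD2r lerDl mulrn_wge0.
Qed.

Lemma cvg_ReImP (T : Type) (F : set_system T) (FF : Filter F) (f : T -> C) (l : C) :
  f @ F --> l <->
  complex.Re (f x) @[x --> F] --> complex.Re l /\
  complex.Im (f x) @[x --> F] --> complex.Im l.
Proof.
split=> [/cvgrPdist_le fl|[/cvgrPdist_le rl /cvgrPdist_le il]].
  split; apply/cvgrPdist_le => e e0.
    have ec : 0 < (e%:C : C) by rewrite ltcR.
    apply: filterS (fl _ ec) => t /normc_leP[h _].
    by rewrite -complex_ReB.
  have ec : 0 < (e%:C : C) by rewrite ltcR.
  apply: filterS (fl _ ec) => t /normc_leP[_ h].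
  by rewrite -complex_ImB.
apply/cvgrPdist_le => e; rewrite ltcE => /andP[/eqP eI e0].
have e20 : 0 < complex.Re e / 2 by rewrite divr_gt0.
near=> t.
rewrite (le_trans (normc_le_ReIm _))//.
rewrite lecE /= eI eqxx /= complex_ReB complex_ImB [leRHS]splitr lerD//.
  by near: t; exact: rl.
by near: t; exact: il.
Unshelve. all: by end_near. Qed.

End MatrixConvergence.

(** * Borel summability of matrix series *)

Section ComplexBorel.
Variable R : realType.
Local Notation C := (complexF R).

Definition borel_regularC (z : nat -> C) (s : C) :=
  borel_regular (fun k => complex.Re (z k)) (complex.Re s) /\
  borel_regular (fun k => complex.Im (z k)) (complex.Im s).

Lemma borel_regularC0 : borel_regularC (fun=> 0) 0.
Proof. by split; exact: borel_regular0. Qed.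

Lemma borel_regularCZD (r : C) (z w : nat -> C) (s t : C) :
  borel_regularC z s -> borel_regularC w t ->
  borel_regularC (fun k => r * z k + w k) (r * s + t).
Proof.
move=> [zr zi] [wr wi]; split.
- have -> : (fun k => complex.Re (r * z k + w k)) =
    (fun k => complex.Re r * complex.Re (z k) +
      (- complex.Im r * complex.Im (z k) + complex.Re (w k))).
    by apply/funext => k; rewrite complex_ReD complex_ReM mulNr addrA.
  rewrite complex_ReD complex_ReM -addrA -mulNr.
  by do 2!apply: borel_regularZD => //.
- have -> : (fun k => complex.Im (r * z k + w k)) =
    (fun k => complex.Re r * complex.Im (z k) +
      (complex.Im r * complex.Re (z k) + complex.Im (w k))).
    by apply/funext => k; rewrite complex_ImD complex_ImM addrA.
  rewrite complex_ImD complex_ImM -addrA.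
  by do 2!apply: borel_regularZD => //.
Qed.

Variable d : nat.
Implicit Types (A B : nat -> 'M[C]_d) (S T U V P : 'M[C]_d).

Definition borel_regular_mx A S := forall i j, borel_regularC (fun k => A k i j) (S i j).

(** Each entry of V *m A k is a fixed linear combination of entries of A k. *)
Lemma borel_regular_mulmx V A S :
  borel_regular_mx A S -> borel_regular_mx (fun k => V *m A k) (V *m S).
Proof.
move=> AS i j; rewrite mxE.
have -> : (fun k => (V *m A k) i j) = (fun k => \sum_l V i l * A k l j).
  by apply/funext => k; rewrite mxE.
elim: (index_enum _) => [|l s IH].
  by rewrite big_nil; under eq_fun => k do rewrite big_nil; exact: borel_regularC0.
rewrite big_cons; under eq_fun => k do rewrite big_cons.
exact: borel_regularCZD.
Qed.

Lemma cvg_mulmx (V : 'M[C]_d) (A : nat -> 'M[C]_d) S :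
  A @ \oo --> S -> (fun n => V *m A n) @ \oo --> V *m S.
Proof.
move=> AS; apply/cvg_mxP => i j; rewrite mxE.
have -> : (fun n => (V *m A n) i j) = (fun n => \sum_l V i l * A n l j).
  by apply/funext => n; rewrite mxE.
apply: cvg_big; first exact: add_continuous.
move=> l _; apply: cvgM; first exact: cvg_cst.
by move/cvg_mxP : AS; exact.
Qed.

Lemma series_entry (u : nat -> 'M[C]_d) n i j :
  series u n i j = series (fun k => u k i j) n.
Proof. by rewrite /series /= summxE. Qed.

Lemma Re_series (z : nat -> C) n :
  complex.Re (series z n) = series (fun k => complex.Re (z k)) n.
Proof.
elim: n => [|n IH]; first by rewrite /series /= !big_geq.
by rewrite !seriesSr complex_ReD IH.
Qed.

Lemma Im_series (z : nat -> C) n :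
  complex.Im (series z n) = series (fun k => complex.Im (z k)) n.
Proof.
elim: n => [|n IH]; first by rewrite /series /= !big_geq.
by rewrite !seriesSr complex_ImD IH.
Qed.

Lemma cvg_mxReImP (T : Type) (F : set_system T) (FF : Filter F) (f : T -> 'M[C]_d) S :
  f @ F --> S <-> forall i j,
    complex.Re (f x i j) @[x --> F] --> complex.Re (S i j) /\
    complex.Im (f x i j) @[x --> F] --> complex.Im (S i j).
Proof.
split=> [/cvg_mxP fS i j|fS]; first by apply/cvg_ReImP.
by apply/cvg_mxP => i j; apply/cvg_ReImP.
Qed.

Lemma mx_summable_toP (u : nat -> 'M[C]_d) S :
  mx_summable_to u S <-> forall i j,
    series (fun k => complex.Re (u k i j)) @ \oo --> complex.Re (S i j) /\
    series (fun k => complex.Im (u k i j)) @ \oo --> complex.Im (S i j).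
Proof.
have sE i j : (fun n => complex.Re (series u n i j)) =
    series (fun k => complex.Re (u k i j)) /\
    (fun n => complex.Im (series u n i j)) =
    series (fun k => complex.Im (u k i j)).
  by split; apply/funext => n; rewrite series_entry ?Re_series ?Im_series.
rewrite /mx_summable_to cvg_mxReImP.
by split=> h i j; have := h i j; have [-> ->] := sE i j.
Qed.

Lemma mul_diag_expmx (D : 'rV[C]_d) n (M : 'M[C]_d) i j :
  (diag_mx D ^+ n *m M) i j = D 0 i ^+ n * M i j.
Proof.
elim: n M => [|n IH] M; first by rewrite expr0 mul1mx mul1r.
by rewrite exprSr -mulmxA IH mul_diag_mx mxE exprSr mulrA.
Qed.

Lemma intertwine_exp (U X Y : 'M[C]_d) n : U *m X = Y *m U ->
  U *m X ^+ n = Y ^+ n *m U.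
Proof.
move=> UX; elim: n => [|n IH]; first by rewrite !expr0 mulmx1 mul1mx.
by rewrite !exprS mulmxA UX -!mulmxA IH.
Qed.

(** In the eigenbasis of P, every matrix in the Euler transform is diagonal. *)
Lemma euler_transform_diag U P A (p : 'I_d -> R) :
  U \in unitmx -> (forall i, 0 < p i) ->
  U *m P = diag_mx (\row_i ((p i)%:C : C)) *m U ->
  forall n i j, (U *m euler_transform P A n) i j =
    ((1 + p i) ^- n.+1)%:C *
    \sum_(k < n.+1) (('C(n, k)%:R * p i ^+ (n - k))%:C : C) * (U *m A k) i j.
Proof.
move=> Uu p0 UP n i j.
pose q : 'rV[C]_d := \row_i ((1 + p i)^-1)%:C.
have UQ : U *m invmx (1%:M + P) = diag_mx q *m U.
  have U1 : diag_mx q *m (U *m (1%:M + P)) = U.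
    apply/matrixP => a b.
    rewrite mulmxDr UP mulmx1 !mul_diag_mx !mxE.
    have pV : ((1 + p a)^-1)%:C * (1 + (p a)%:C) = 1 :> C.
      rewrite -[X in _ * (X + _)](rmorph1 (real_complex R)) -rmorphD -rmorphM.
      by rewrite mulVf ?rmorph1// gt_eqF// addr_gt0.
    by rewrite -{1}[U a b]mul1r -mulrDl mulrA pV mul1r.
  (* U1 exhibits a left inverse of 1 + P. *)
  have Pu : 1%:M + P \in unitmx.
    have := congr1 (fun M => invmx U *m M) U1.
    by rewrite mulVmx// !mulmxA => /mulmx1_unit[].
  by rewrite -{1}U1 -!mulmxA mulmxV// mulmx1.
rewrite /euler_transform mulmx_sumr summxE mulr_sumr; apply: eq_bigr => k _.
rewrite -scalemxAr mxE !mulmxA (intertwine_exp _ UQ) -(mulmxA _ U) (intertwine_exp _ UP).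
rewrite -!mulmxA !mul_diag_expmx !mxE !mulrA.
rewrite -!rmorphXn /= rmorphM rmorph_nat exprVn; congr (_ * _).
by rewrite mulrAC mulrC mulrA.
Qed.

(** The coefficients in [euler_transform_diag] are real, so the real and the
    imaginary parts of each entry of U *m A are scalar Euler summable. *)
Lemma borel_regular_diag U P A S (p : 'I_d -> R) :
  U \in unitmx -> (forall i, 0 < p i) ->
  U *m P = diag_mx (\row_i ((p i)%:C : C)) *m U ->
  euler_summable_to P A S -> borel_regular_mx (fun k => U *m A k) (U *m S).
Proof.
move=> Uu p0 UP; rewrite /euler_summable_to /mx_summable_to => h.
move: {h}(cvg_mulmx (V := U) h).
have -> : (fun n => U *m series (euler_transform P A) n) =
    series (fun n => U *m euler_transform P A n).
  by apply/funext => n; rewrite /series /= mulmx_sumr.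
move=> /mx_summable_toP h i j; have [hr hi] := h i j.
have UE := euler_transform_diag A Uu p0 UP.
split; apply: (borel_regular_euler (p0 i)).
- move: hr; rewrite (_ : (fun k => complex.Re _) =
    euler_coeff (p i) (fun k => complex.Re ((U *m A k) i j)))//.
  apply/funext => n; rewrite UE complex_ReZ; congr (_ * _).
  rewrite (big_morph _ (@complex_ReD R) erefl); apply: eq_bigr => k _.
  by rewrite complex_ReZ mulrA.
- move: hi; rewrite (_ : (fun k => complex.Im _) =
    euler_coeff (p i) (fun k => complex.Im ((U *m A k) i j)))//.
  apply/funext => n; rewrite UE complex_ImZ; congr (_ * _).
  rewrite (big_morph _ (@complex_ImD R) erefl); apply: eq_bigr => k _.
  by rewrite complex_ImZ mulrA.
Qed.

(** Regularity holds for U *m A in the eigenbasis, and invmx U brings it back. *)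
Lemma euler_summable_borel_regular P A S : posdefmx P ->
  euler_summable_to P A S -> borel_regular_mx A S.
Proof.
move=> /posdef_diagonalization[U [q [Uu q0 UP]]] AS.
have qE : q = \row_i (((complex.Re (q 0 i))%:C) : C).
  apply/rowP => i; rewrite mxE; have := q0 i; rewrite ltcE => /andP[/eqP + _].
  by case: (q 0 i) => a b /= ->.
have p0 i : 0 < complex.Re (q 0 i) by have := q0 i; rewrite ltcE => /andP[_].
rewrite qE in UP.
have := borel_regular_mulmx (invmx U) (borel_regular_diag Uu p0 UP AS).
rewrite mulKmx//; under eq_fun => k do rewrite mulKmx//.
by [].
Qed.

Section BorelSums.
Variable u : nat -> 'M[C]_d.
Hypothesis ub : forall i j, exp_bounded (fun k => complex.Re (u k i j)) /\
  exp_bounded (fun k => complex.Im (u k i j)).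

Lemma borel_term_summable x : mx_summable_to (borel_term u x)
  (\matrix_(i, j) (egf (fun k => complex.Re (u k i j)) x +i*
                   egf (fun k => complex.Im (u k i j)) x)).
Proof.
apply/mx_summable_toP => i j; have [rb ib] := ub i j; rewrite mxE /=; split.
- have -> : (fun k => complex.Re (borel_term u x k i j)) =
    (fun k => egf_coeff (fun k => complex.Re (u k i j)) k * x ^+ k).
    apply/funext => k; rewrite /borel_term mxE complex_ReZ /egf_coeff; ring.
  exact: is_cvg_egf.
- have -> : (fun k => complex.Im (borel_term u x k i j)) =
    (fun k => egf_coeff (fun k => complex.Im (u k i j)) k * x ^+ k).
    apply/funext => k; rewrite /borel_term mxE complex_ImZ /egf_coeff; ring.
  exact: is_cvg_egf.
Qed.

Lemma borel_sumE x : mx_sum (borel_term u x) =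
  \matrix_(i, j) (egf (fun k => complex.Re (u k i j)) x +i*
                  egf (fun k => complex.Im (u k i j)) x).
Proof. by apply/cvg_lim; [exact: norm_hausdorff|exact: borel_term_summable]. Qed.

Lemma borel_term_summable_sum x :
  mx_summable_to (borel_term u x) (mx_sum (borel_term u x)).
Proof. by rewrite borel_sumE; exact: borel_term_summable. Qed.

Lemma Re_borel_sum x i j :
  complex.Re (((expR (- x))%:C *: mx_sum (borel_term u x)) i j) =
  borel_mean (fun k => complex.Re (u k i j)) x.
Proof. by rewrite borel_sumE mxE complex_ReZ mxE. Qed.

Lemma Im_borel_sum x i j :
  complex.Im (((expR (- x))%:C *: mx_sum (borel_term u x)) i j) =
  borel_mean (fun k => complex.Im (u k i j)) x.
Proof. by rewrite borel_sumE mxE complex_ImZ mxE. Qed.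

End BorelSums.

Lemma partial_sum_entry A i j :
  (fun k => complex.Re (partial_sum A k i j)) =
    (fun k => series (fun m => complex.Re (A m i j)) k.+1) /\
  (fun k => complex.Im (partial_sum A k i j)) =
    (fun k => series (fun m => complex.Im (A m i j)) k.+1).
Proof.
split; apply/funext => k; rewrite -?Re_series -?Im_series -series_entry;
by rewrite /partial_sum /series /= big_mkord.
Qed.

Lemma borel_regular_weakly A S : borel_regular_mx A S ->
  weakly_borel_summable_to A S.
Proof.
move=> AS.
have ub i j : exp_bounded (fun k => complex.Re (partial_sum A k i j)) /\
    exp_bounded (fun k => complex.Im (partial_sum A k i j)).
  have [-> ->] := partial_sum_entry A i j; have [[rb _ _] [ib _ _]] := AS i j.
  by split; apply/exp_bounded_shift/exp_bounded_series.
split=> [x x0|].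
  exists ((expR (- x))%:C *: mx_sum (borel_term (partial_sum A) x)).
  have h : mx_summable_to _ _ := borel_term_summable_sum ub (x := x).
  rewrite /mx_summable_to.
  have -> : series (fun k => (expR (- x))%:C *: borel_term (partial_sum A) x k) =
    (fun n => (expR (- x))%:C *: series (borel_term (partial_sum A) x) n).
    by apply/funext => n; rewrite /series /= scaler_sumr.
  apply: cvgZl_tmp; exact: h.
apply/cvg_mxReImP => i j; have [Sr Si] := AS i j; have [rE iE] := partial_sum_entry A i j.
have rwE : (fun x => complex.Re (((expR (- x))%:C *: weak_borel A x) i j)) =
    borel_mean (fun k => series (fun m => complex.Re (A m i j)) k.+1).
  by apply/funext => x; rewrite Re_borel_sum// rE.
have iwE : (fun x => complex.Im (((expR (- x))%:C *: weak_borel A x) i j)) =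
    borel_mean (fun k => series (fun m => complex.Im (A m i j)) k.+1).
  by apply/funext => x; rewrite Im_borel_sum// iE.
by rewrite rwE iwE; split; exact: borel_regular_weak.
Qed.

(** The mean of [series a] is the primitive of that of a vanishing at 0, so its
    value at x is the integral over [0, x]. *)
Lemma borel_regular_strongly A S : borel_regular_mx A S ->
  strongly_borel_summable_to A S.
Proof.
move=> AS.
have ub i j : exp_bounded (fun k => complex.Re (A k i j)) /\
    exp_bounded (fun k => complex.Im (A k i j)).
  by have [[rb _ _] [ib _ _]] := AS i j.
have rE i j : (fun t => complex.Re (strong_borel_integrand A t i j)) =
    borel_mean (fun k => complex.Re (A k i j)).
  by apply/funext => t; exact: Re_borel_sum.
have iE i j : (fun t => complex.Im (strong_borel_integrand A t i j)) =
    borel_mean (fun k => complex.Im (A k i j)).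
  by apply/funext => t; exact: Im_borel_sum.
split=> [x x0|].
  split; first by eexists; exact: borel_term_summable.
  move=> i j; have [rb ib] := ub i j.
  rewrite rE iE.
  by split; exact: borel_mean_integrable.
apply/cvg_mxReImP => i j; have [[rb _ Sr] [ib _ Si]] := AS i j.
split.
- apply: cvg_trans Sr; apply: near_eq_cvg; near=> x; rewrite /mx_integral mxE /=.
  rewrite rE borel_mean_integral//.
- apply: cvg_trans Si; apply: near_eq_cvg; near=> x; rewrite /mx_integral mxE /=.
  rewrite iE borel_mean_integral//.
Unshelve. all: by end_near. Qed.

End ComplexBorel.

Theorem theorem4p18 (R : realType) (d : nat) (A : nat -> 'M[complexF R]_d)
    (S P : 'M[complexF R]_d) :
  posdefmx P -> euler_summable_to P A S ->
  weakly_borel_summable_to A S /\ strongly_borel_summable_to A S.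
Proof.
move=> P0 AS; have H := euler_summable_borel_regular P0 AS.
by split; [exact: borel_regular_weakly|exact: borel_regular_strongly].
Qed.
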